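(* Let $\mathcal U$ be a non-principal p-point ultrafilter on $\omega$ and let $\mathfrak I=\{\omega\setminus X\mid X\in\mathcal U\}$ be its dual ideal. Then the Grigorieff forcing $\mathbb P(\mathcal U)=\{p:\omega\to 2\mid \mathrm{dom}(p)\in\mathfrak I\}$, ordered by $q\le p$ iff $q\supseteq p$, does not satisfy Axiom A.
   Context: Here $p$ ranges over partial functions from $\omega$ to $2=\{0,1\}$. A partial order $(\mathbb P,\le)$ satisfies Axiom A if there are partial orders $\le_n$ ($n\in\omega$) on $\mathbb P$ such that: (i) $p\le_0 q$ implies $p\le q$; (ii) $p\le_{n+1}q$ implies $p\le_n q$; (iii) whenever $p_0\ge_0 p_1\ge_1 p_2\ge_2\cdots$ (a fusion sequence), there is $q\in\mathbb P$ with $q\le_n p_n$ for all $n$; (iv) for every $p\in\mathbb P$, every $n\in\omega$ and every $\mathbb P$-name $\dot\alpha$ for an ordinal, there are $q\le_n p$ and a countable set $B$ with $q\Vdash\dot\alpha\in B$. A p-point ultrafilter is a non-principal ultrafilter $\mathcal U$ on $\omega$ such that for every partition $\{J_n\mid n\in\omega\}$ of $\omega$ with each $J_n\notin\mathcal U$ there is $Y\in\mathcal U$ with $|Y\cap J_n|<\omega$ for all $n$. *)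

(* Defs.v *)
Definition complement (A : nat -> Prop) : nat -> Prop := fun n => ~ A n.

Definition ultrafilter (U : (nat -> Prop) -> Prop) : Prop :=
  U (fun _ => True) /\
  ~ U (fun _ => False) /\
  (forall A B : nat -> Prop, U A -> (forall n, A n -> B n) -> U B) /\
  (forall A B : nat -> Prop, U A -> U B -> U (fun n => A n /\ B n)) /\
  (forall A : nat -> Prop, U A \/ U (complement A)).

Definition nonprincipal (U : (nat -> Prop) -> Prop) : Prop :=
  forall k : nat, ~ U (fun n => n = k).

Definition finite_nat (A : nat -> Prop) : Prop :=
  exists m : nat, forall k, A k -> k < m.

Definition partition_omega (J : nat -> nat -> Prop) : Prop :=
  (forall k, exists n, J n k) /\
  (forall n m k, J n k -> J m k -> n = m).

Definition p_point (U : (nat -> Prop) -> Prop) : Prop :=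
  ultrafilter U /\ nonprincipal U /\
  forall J : nat -> nat -> Prop,
    partition_omega J -> (forall n, ~ U (J n)) ->
    exists Y, U Y /\ forall n, finite_nat (fun k => Y k /\ J n k).

Definition is_partial_order {P : Type} (r : P -> P -> Prop) : Prop :=
  (forall p, r p p) /\
  (forall p q s, r p q -> r q s -> r p s) /\
  (forall p q, r p q -> r q p -> p = q).

(* A P-name for an element of a ground-model set X, represented (as usual)
   by the partial function D with D q = Some x  iff  q forces (name = x).
   Requirements: the set of conditions deciding the value is dense,
   decisions persist to stronger conditions, and compatible conditions
   decide the same value. *)
Definition is_name {P : Type} (le : P -> P -> Prop) {X : Type}
  (D : P -> option X) : Prop :=
  (forall p, exists q, le q p /\ D q <> None) /\
  (forall p q x, le q p -> D p = Some x -> D q = Some x) /\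
  (forall p q x y, D p = Some x -> D q = Some y ->
      (exists r, le r p /\ le r q) -> x = y).

Definition forces_in {P : Type} (le : P -> P -> Prop) {X : Type}
  (q : P) (D : P -> option X) (B : X -> Prop) : Prop :=
  forall r, le r q -> exists s x, le s r /\ D s = Some x /\ B x.

Definition countable_set {X : Type} (B : X -> Prop) : Prop :=
  exists g : X -> nat, forall x y, B x -> B y -> g x = g y -> x = y.

Definition AxiomA (P : Type) (le : P -> P -> Prop) : Prop :=
  exists len : nat -> P -> P -> Prop,
    (forall n, is_partial_order (len n)) /\
    (forall p q, len 0 p q -> le p q) /\
    (forall n p q, len (S n) p q -> len n p q) /\
    (forall ps : nat -> P, (forall n, len n (ps (S n)) (ps n)) ->
        exists q, forall n, len n q (ps n)) /\
    (forall (p : P) (n : nat) (X : Type) (D : P -> option X),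
        is_name le D ->
        exists q, len n q p /\
          exists B : X -> Prop, countable_set B /\ forces_in le q D B).

(* partial functions omega -> 2 as nat -> option bool; dom p = {n | p n <> None}.
   dom p in the dual ideal  iff  omega \ dom p in U. *)
Definition Grigorieff (U : (nat -> Prop) -> Prop) : Type :=
  { p : nat -> option bool | U (fun n => p n = None) }.

Definition grig_le (U : (nat -> Prop) -> Prop) (q p : Grigorieff U) : Prop :=
  forall n b, proj1_sig p n = Some b -> proj1_sig q n = Some b.

(* Main.v *)
(** Deciding the restriction of the generic function to a set [I] of the dual
    ideal up to countably many values forces [dom q] to contain almost all of
    [I].  Hence, if Axiom A held, then for all [p] and [n] there would be [m]
    such that every interval [[m, k)] is contained in [dom q] for some
    [q <=_n p]: otherwise there are consecutive bad intervals, and either the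
    union of the even ones or the union of the odd ones lies in the ideal.
    Two interleaved fusion sequences then produce conditions whose domains
    together cover a cofinite set, which is impossible. *)

Require Import Defs.
From Stdlib Require Import Arith Lia Classical ClassicalEpsilon.
From Stdlib Require Import FunctionalExtensionality.

(** * Infinite sets of naturals and characteristic functions *)

Lemma injective_enumeration (A : nat -> Prop) :
  ~ finite_nat A ->
  exists e : nat -> nat, (forall i, A (e i)) /\ (forall i j, e i = e j -> i = j).
Proof.
  intros hA.
  assert (hnext : forall m, exists k, m <= k /\ A k).
  { intros m. apply NNPP. intros hno. apply hA. exists m. intros k hk.
    destruct (Nat.lt_ge_cases k m) as [hlt | hge]; [exact hlt |].
    exfalso. apply hno. exists k. auto. }
  destruct (choice _ hnext) as [f hf].
  pose (e := nat_rect (fun _ => nat) (f 0) (fun _ k => f (S k))).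
  assert (hstep : forall i, e i < e (S i)).
  { intros i. destruct (hf (S (e i))) as [h _]. exact h. }
  assert (hmono : forall i j, i < j -> e i < e j).
  { intros i j hij. induction hij as [| j _ IH]; [apply hstep |].
    specialize (hstep j). lia. }
  exists e. split.
  - intros [| i]; apply hf.
  - intros i j hij.
    destruct (Nat.lt_trichotomy i j) as [h | [h | h]]; [| exact h |];
      apply hmono in h; lia.
Qed.

Definition truth (Q : Prop) : bool :=
  if excluded_middle_informative Q then true else false.

Lemma truth_true (Q : Prop) : truth Q = true <-> Q.
Proof.
  unfold truth. destruct (excluded_middle_informative Q); split; easy.
Qed.

(** * Ultrafilters and extension of Grigorieff conditions *)

Section Ultrafilter.

Variable U : (nat -> Prop) -> Prop.
Hypothesis hU : ultrafilter U.

Let U_full : U (fun _ => True) := proj1 hU.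
Let U_empty : ~ U (fun _ => False) := proj1 (proj2 hU).
Let U_up := proj1 (proj2 (proj2 hU)).
Let U_meet := proj1 (proj2 (proj2 (proj2 hU))).
Let U_dich := proj2 (proj2 (proj2 (proj2 hU))).

Lemma nonprincipal_infinite (hn : nonprincipal U) (A : nat -> Prop) :
  U A -> ~ finite_nat A.
Proof.
  intros hA [m hm]. revert A hA hm.
  induction m as [| m IH]; intros A hA hm.
  - apply U_empty. apply (U_up _ _ hA). intros k hk. specialize (hm k hk). lia.
  - destruct (U_dich (fun k => k = m)) as [h | h]; [exact (hn m h) |].
    apply (IH _ (U_meet _ _ hA h)). intros k [hk hne].
    unfold complement in hne. specialize (hm k hk). lia.
Qed.

Definition dom (p : Grigorieff U) (n : nat) : Prop := proj1_sig p n <> None.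

Lemma dom_le (p q : Grigorieff U) (n : nat) : grig_le U q p -> dom p n -> dom q n.
Proof.
  intros hqp. unfold dom. destruct (proj1_sig p n) as [b |] eqn:hb; [| easy].
  rewrite (hqp n b hb). easy.
Qed.

(** The points left undefined include the intersection of two sets of [U]. Values already fixed by
    [p] take precedence over [v], so [v] can be prescribed freely only on [I] minus [dom p]. *)
Lemma extend_on (p : Grigorieff U) (I : nat -> Prop) (v : nat -> bool) :
  U (complement I) ->
  exists q, grig_le U q p /\ (forall n, I n -> dom q n) /\
    (forall n, I n -> ~ dom p n -> proj1_sig q n = Some (v n)).
Proof.
  intros hI.
  pose (f := fun n => match proj1_sig p n with
    | Some b => Some b
    | None => if truth (I n) then Some (v n) else None end).
  assert (hf : U (fun n => f n = None)).
  { apply (U_up _ _ (U_meet _ _ (proj2_sig p) hI)).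
    intros n [hp hnI]. unfold f. rewrite hp.
    destruct (truth (I n)) eqn:ht; [| easy].
    rewrite truth_true in ht. contradiction. }
  assert (hv : forall n, I n -> ~ dom p n -> f n = Some (v n)).
  { intros n hn hp. unfold f, dom in *.
    destruct (proj1_sig p n); [exfalso; apply hp; easy |].
    rewrite (proj2 (truth_true _) hn). easy. }
  exists (exist _ f hf). split; [| split].
  - intros n b hb. simpl. unfold f. rewrite hb. easy.
  - intros n hn. unfold dom; simpl.
    destruct (classic (dom p n)) as [hp | hp].
    + unfold f, dom in *. destruct (proj1_sig p n); easy.
    + rewrite (hv n hn hp). easy.
  - exact hv.
Qed.

(** * Names for restrictions of the generic function *)

Definition restrict (I : nat -> Prop) (p : Grigorieff U) : nat -> bool :=
  fun n => truth (I n /\ proj1_sig p n = Some true).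

(** A condition decides the generic function on all of [I] once its domain contains [I]. The decided
    value is padded with [false] off [I], so two values are equal as soon as they agree on [I]. *)
Definition generic_restriction (I : nat -> Prop) (p : Grigorieff U) :
  option (nat -> bool) :=
  if excluded_middle_informative (forall n, I n -> dom p n)
  then Some (restrict I p) else None.

Lemma generic_restriction_Some (I : nat -> Prop) (p : Grigorieff U) x :
  generic_restriction I p = Some x <->
  (forall n, I n -> dom p n) /\ restrict I p = x.
Proof.
  unfold generic_restriction.
  destruct (excluded_middle_informative _) as [h | h]; split.
  - intros [= hx]. auto.
  - intros [_ hx]. congruence.
  - easy.
  - intros [h' _]. contradiction.
Qed.

Lemma restrict_le (I : nat -> Prop) (p q : Grigorieff U) :
  grig_le U q p -> (forall n, I n -> dom p n) -> restrict I q = restrict I p.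
Proof.
  intros hqp hI. apply functional_extensionality. intros n.
  assert (heq : I n -> proj1_sig q n = proj1_sig p n).
  { intros hn. specialize (hI n hn). unfold dom in hI.
    destruct (proj1_sig p n) as [b |] eqn:hb; [exact (hqp n b hb) | easy]. }
  apply Bool.eq_true_iff_eq. unfold restrict. rewrite !truth_true.
  split; intros [hn h]; rewrite heq in * by exact hn; auto.
Qed.

Lemma generic_restriction_name (I : nat -> Prop) :
  U (complement I) -> is_name (grig_le U) (generic_restriction I).
Proof.
  intros hI.
  assert (hpers : forall p q x, grig_le U q p ->
    generic_restriction I p = Some x -> generic_restriction I q = Some x).
  { intros p q x hqp hx. apply generic_restriction_Some in hx as [hd hx].
    apply generic_restriction_Some. split.
    - intros n hn. exact (dom_le _ _ n hqp (hd n hn)).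
    - rewrite (restrict_le I p q hqp hd). exact hx. }
  split; [| split].
  - intros p. destruct (extend_on p I (fun _ => false) hI) as [q [hqp [hd _]]].
    exists q. split; [exact hqp |].
    rewrite (proj2 (generic_restriction_Some I q _) (conj hd eq_refl)). easy.
  - exact hpers.
  - intros p q x y hx hy [r [hrp hrq]].
    pose proof (hpers _ _ _ hrp hx). pose proof (hpers _ _ _ hrq hy). congruence.
Qed.

(** If infinitely many points of [I] were still free, each of the countably many candidates in [B]
    could be given its own free point, and a single extension of [q] would refute them all. *)
Lemma countable_decision_almost_contains (I : nat -> Prop) (q : Grigorieff U) B :
  U (complement I) -> countable_set B ->
  forces_in (grig_le U) q (generic_restriction I) B ->
  finite_nat (fun n => I n /\ ~ dom q n).
Proof.
  intros hI [g hg] hforce. apply NNPP. intros hinf.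
  destruct (injective_enumeration _ hinf) as [e [he hinj]].
  (* Cantor's diagonal: [v] disagrees with each [x] in [B] at [e (g x)]. *)
  pose (v := fun n => truth (exists x, B x /\ e (g x) = n /\ x n = false)).
  destruct (extend_on q I v hI) as [r [hrq [_ hv]]].
  destruct (hforce r hrq) as [s [x [hsr [hx hB]]]].
  apply generic_restriction_Some in hx as [_ hx].
  destruct (he (g x)) as [hIn hdn].
  set (n := e (g x)) in *.
  pose proof (hsr _ _ (hv n hIn hdn)) as hs.
  assert (hxv : x n = v n).
  { rewrite <- hx. unfold restrict. rewrite hs.
    apply Bool.eq_true_iff_eq. rewrite truth_true.
    split; [intros [_ h]; congruence | intros h; rewrite h; auto]. }
  (* If [x n] is true, then so is [v n], hence some [y] in [B] with the code of [x] is false at [n];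
     but [y = x]. If [x n] is false, then [x] itself makes [v n] true. *)
  destruct (x n) eqn:hxn.
  - symmetry in hxv. unfold v in hxv. rewrite truth_true in hxv. destruct hxv as [y [hBy [hy hyn]]].
    apply hinj, (hg y x hBy hB) in hy. congruence.
  - assert (v n = true); [| congruence].
    unfold v. rewrite truth_true. exists x. auto.
Qed.

(** * Interval partitions and interleaved fusion *)

Lemma between_consecutive (a : nat -> nat) :
  (forall i, a i < a (S i)) ->
  forall n, a 0 <= n -> exists i, a i <= n < a (S i).
Proof.
  intros ha n hn.
  assert (hub : forall j, n < a j -> exists i, a i <= n < a (S i)).
  { induction j as [| j IH]; intros hj; [lia |].
    destruct (Nat.lt_ge_cases n (a j)) as [h | h]; [auto | exists j; lia]. }
  apply (hub (S n)).
  assert (hge : forall j, j <= a j).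
  { induction j as [| j IH]; [lia | specialize (ha j); lia]. }
  specialize (hge (S n)). lia.
Qed.

Lemma alternate_intervals_in_ideal (a : nat -> nat) :
  (forall i, a i < a (S i)) ->
  exists I, U (complement I) /\
    forall b, exists i, b <= a i /\ forall n, a i <= n < a (S i) -> I n.
Proof.
  intros ha.
  assert (hmono : forall i j, i <= j -> a i <= a j).
  { intros i j hij. induction hij as [| j _ IH]; [lia | specialize (ha j); lia]. }
  assert (hge : forall j, j <= a j).
  { induction j as [| j IH]; [lia | specialize (ha j); lia]. }
  pose (E := fun n => exists i, a (2 * i) <= n < a (S (2 * i))).
  destruct (U_dich E) as [h | h].
  - exists (complement E). split.
    + apply (U_up _ _ h). intros n hn hc. exact (hc hn).
    + intros b. exists (S (2 * b)). split; [specialize (hge (S (2 * b))); lia |].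
      intros n hn [i hi].
      destruct (Nat.le_gt_cases i b) as [hib | hib].
      (* The even interval number [2 * i] ends before the odd interval number [2 * b + 1] begins, or
         starts after its end. *)
      * specialize (hmono (S (2 * i)) (S (2 * b))). lia.
      * specialize (hmono (S (S (2 * b))) (2 * i)). lia.
  - exists E. split; [exact h |].
    intros b. exists (2 * b). split; [specialize (hge (2 * b)); lia |].
    intros n hn. exists b. exact hn.
Qed.

(** Meant for [R q := len n q p]. What matters is that [m] does not depend on [k]: the right end of
    the covered interval may be chosen after [m] is known. *)
Lemma covers_intervals (R : Grigorieff U -> Prop) :
  (forall I, U (complement I) ->
    exists q, R q /\ finite_nat (fun n => I n /\ ~ dom q n)) ->
  exists m, forall k, exists q, R q /\ forall n, m <= n < k -> dom q n.
Proof.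
  intros hR. apply NNPP. intros hno.
  assert (hbad : forall m, exists k,
    ~ exists q, R q /\ forall n, m <= n < k -> dom q n).
  { intros m. apply not_all_ex_not. intros h. apply hno. exists m. exact h. }
  destruct (choice _ hbad) as [f hf].
  assert (hlt : forall m, m < f m).
  { intros m. destruct (Nat.lt_ge_cases m (f m)) as [h | h]; [exact h |].
    exfalso. apply (hf m).
    (* Applied to the empty set, [hR] gives some member of [R], and it covers an empty interval
       vacuously; so bad intervals are nonempty. *)
    assert (hfull : U (complement (fun _ => False))).
    { apply (U_up _ _ U_full). intros n _ h'. exact h'. }
    destruct (hR _ hfull) as [q [hq _]].
    exists q. split; [exact hq | intros n hn; lia]. }
  pose (a := nat_rect (fun _ => nat) 0 (fun _ m => f m)).
  destruct (alternate_intervals_in_ideal a (fun i => hlt (a i)))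
    as [I [hI hcov]].
  destruct (hR I hI) as [q [hq [b hb]]].
  destruct (hcov b) as [i [hbi hi]].
  apply (hf (a i)). exists q. split; [exact hq |].
  intros n hn. apply NNPP. intros hd.
  specialize (hb n (conj (hi n hn) hd)). lia.
Qed.

(** At step [n] the first condition covers from [k] up to some [j] beyond the threshold of the
    second; then the second covers from [j] up to some [k'] beyond the next threshold of the
    first. *)
Lemma interleaved_fusions (len : nat -> Grigorieff U -> Grigorieff U -> Prop) :
  (forall p n, exists m, forall k, exists q,
    len n q p /\ forall i, m <= i < k -> dom q i) ->
  exists (p q : nat -> Grigorieff U) (a : nat -> nat),
    (forall n, len n (p (S n)) (p n)) /\ (forall n, len n (q (S n)) (q n)) /\
    (forall n, a n < a (S n)) /\
    (forall n i, a n <= i < a (S n) -> dom (p (S n)) i \/ dom (q (S n)) i).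
Proof.
  intros hcov.
  destruct (choice (fun pn m => forall k, exists q,
    len (snd pn) q (fst pn) /\ forall i, m <= i < k -> dom q i)
    (fun pn => hcov (fst pn) (snd pn))) as [m hm].
  pose (St := (Grigorieff U * Grigorieff U * nat)%type).
  (* Only the threshold of the first condition needs an invariant, since that of the second is met
     by the choice of [j]. *)
  pose (Good := fun n (s : St) => m (fst (fst s), n) <= snd s).
  pose (Next := fun n (s t : St) =>
    len n (fst (fst t)) (fst (fst s)) /\ len n (snd (fst t)) (snd (fst s)) /\
    snd s < snd t /\
    forall i, snd s <= i < snd t -> dom (fst (fst t)) i \/ dom (snd (fst t)) i).
  assert (hstep : forall ns : nat * St, exists t, Good (fst ns) (snd ns) ->
    Good (S (fst ns)) t /\ Next (fst ns) (snd ns) t).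
  { intros [n [[p q] k]].
    pose (j := max (S k) (m (q, n))).
    assert (hj : k < j /\ m (q, n) <= j) by (unfold j; lia).
    clearbody j.
    destruct (hm (p, n) j) as [p' [hp hdp]].
    pose (k' := max j (m (p', S n))).
    assert (hk : j <= k' /\ m (p', S n) <= k') by (unfold k'; lia).
    clearbody k'.
    destruct (hm (q, n) k') as [q' [hq hdq]].
    exists (p', q', k'). unfold Good, Next. simpl in *. intros hg.
    repeat split; [lia | exact hp | exact hq | lia |].
    intros i hi. destruct (Nat.lt_ge_cases i j) as [h | h].
    - left. apply hdp. lia.
    - right. apply hdq. lia. }
  destruct (choice _ hstep) as [nxt hnxt].
  pose (p0 := exist _ (fun _ => None) (U_up _ _ U_full (fun _ _ => eq_refl))
    : Grigorieff U).
  pose (s := nat_rect (fun _ => St) (p0, p0, m (p0, 0)) (fun n t => nxt (n, t))).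
  assert (hgood : forall n, Good n (s n)).
  { induction n as [| n IH]; [apply le_n | exact (proj1 (hnxt (n, s n) IH))]. }
  assert (hnext : forall n, Next n (s n) (s (S n))).
  { intros n. exact (proj2 (hnxt (n, s n) (hgood n))). }
  exists (fun n => fst (fst (s n))), (fun n => snd (fst (s n))), (fun n => snd (s n)).
  repeat split; intros n; apply (hnext n).
Qed.

End Ultrafilter.

Theorem theorem1 (U : (nat -> Prop) -> Prop) (hU : p_point U) :
  ~ AxiomA (Grigorieff U) (grig_le U).
Proof.
  destruct hU as [hu [hn _]].
  intros [len [_ [hle0 [hdec [hfus hname]]]]].
  assert (hle : forall n p q, len n p q -> grig_le U p q).
  { induction n as [| n IH]; auto. }
  destruct (interleaved_fusions U hu len) as [p [q [a [hp [hq [ha hcov]]]]]].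
  { intros p n. apply (covers_intervals U hu (fun q => len n q p)).
    intros I hI.
    destruct (hname p n _ _ (generic_restriction_name U hu I hI))
      as [q [hqp [B [hB hf]]]].
    exists q. split; [exact hqp |].
    exact (countable_decision_almost_contains U hu I q B hI hB hf). }
  destruct (hfus p hp) as [p' hp']. destruct (hfus q hq) as [q' hq'].
  (* The points undefined in both lower bounds form a set in [U], yet every point from [a 0] on lies
     in an interval covered at some stage by one of the two sequences. *)
  apply (nonprincipal_infinite U hu hn
    (fun n => proj1_sig p' n = None /\ proj1_sig q' n = None)).
  - apply hu; [exact (proj2_sig p') | exact (proj2_sig q')].
  - exists (a 0). intros i [hpi hqi].
    destruct (Nat.lt_ge_cases i (a 0)) as [h | h]; [exact h | exfalso].
    destruct (between_consecutive a ha i h) as [n hi].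
    destruct (hcov n i hi) as [hd | hd].
    + exact (dom_le U _ _ i (hle _ _ _ (hp' (S n))) hd hpi).
    + exact (dom_le U _ _ i (hle _ _ _ (hq' (S n))) hd hqi).
Qed.
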